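(* Let $\mathbb K$ be a field of characteristic $0$ and let $(\mathfrak g=\mathfrak U'\oplus\mathfrak V',B',\tilde D)$ be a special symplectic Manin algebra over $\mathbb K$. Let $\mathfrak z(\mathfrak g)$ denote the centre of $\mathfrak g$. (i) If $\tilde D$ admits an eigenvector $z\in(\mathfrak z(\mathfrak g)\cap\mathfrak U')+(\mathfrak z(\mathfrak g)\cap\mathfrak V')$, then $(\mathfrak g=\mathfrak U'\oplus\mathfrak V',B',\tilde D)$ is a special double extension of a special symplectic Manin algebra $(\mathfrak G=\mathfrak U\oplus\mathfrak V,B,D)$ by means of a pair $(\delta,c)$, where $c\in\mathfrak V$ and $\delta$ is a skew-symmetric derivation of $\mathfrak G$ leaving $\mathfrak V$ invariant. (ii) In particular, if $\mathbb K$ is algebraically closed, then $(\mathfrak g=\mathfrak U'\oplus\mathfrak V',B',\tilde D)$ may be obtained from a two-dimensional special symplectic Manin algebra by a sequence of special double extensions by the one-dimensional algebra.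
   Context: All Lie algebras are finite-dimensional over a field $\mathbb K$ of characteristic $0$. A quadratic Lie algebra $(\mathfrak g,B)$ is a Lie algebra $\mathfrak g$ with a non-degenerate symmetric bilinear form $B$ (an invariant scalar product) such that $B([x,y],z)=B(x,[y,z])$ for all $x,y,z\in\mathfrak g$. A derivation $D$ of $\mathfrak g$ is skew-symmetric if $B(Dx,y)=-B(x,Dy)$ for all $x,y$; the Lie algebra of such derivations is $\mathrm{Der}_a(\mathfrak g,B)$. A Manin algebra $(\mathfrak g=\mathfrak U\oplus\mathfrak V,B)$ is a Lie algebra $\mathfrak g$ with an invariant scalar product $B$ which is the vector space direct sum of two Lie subalgebras $\mathfrak U,\mathfrak V$ that are completely isotropic, i.e. $B(\mathfrak U,\mathfrak U)=B(\mathfrak V,\mathfrak V)=\{0\}$. It is a special symplectic Manin algebra if $\mathfrak g$ admits a symplectic structure $\omega$ (a non-degenerate skew-symmetric bilinear form with $\omega([x,y],z)+\omega([y,z],x)+\omega([z,x],y)=0$) such that $\omega(\mathfrak U,\mathfrak U)=\omega(\mathfrak V,\mathfrak V)=\{0\}$; equivalently, if there is an invertible $D\in\mathrm{Der}_a(\mathfrak g,B)$ with $D(\mathfrak U)\subseteq\mathfrak U$ and $D(\mathfrak V)\subseteq\mathfrak V$, the two being related by $\omega(x,y)=B(Dx,y)$. It is then denoted $(\mathfrak g=\mathfrak U\oplus\mathfrak V,B,D)$. Quadratic double extension: given a quadratic Lie algebra $(\mathfrak G,B)$ and $\delta\in\mathrm{Der}_a(\mathfrak G,B)$, the double extension of $(\mathfrak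 G,B)$ by the one-dimensional Lie algebra by means of $\delta$ is $\mathbb Ke\oplus\mathfrak G\oplus\mathbb Ke^*$ with bracket $$[\alpha e+x+\alpha'e^*,\gamma e+y+\gamma'e^*]=[x,y]_{\mathfrak G}+\alpha\delta(y)-\gamma\delta(x)+B(\delta(x),y)e^*$$ and invariant scalar product $T(\alpha e+x+\alpha'e^*,\gamma e+y+\gamma'e^* )=B(x,y)+\alpha\gamma'+\gamma\alpha'$, for $x,y\in\mathfrak G$ and $\alpha,\alpha',\gamma,\gamma'\in\mathbb K$. Double extension of a Manin algebra: if $(\mathfrak G=\mathfrak U\oplus\mathfrak V,B)$ is a Manin algebra and $\delta\in\mathrm{Der}_a(\mathfrak G,B)$ satisfies $\delta(\mathfrak V)\subseteq\mathfrak V$, the double extension of the Manin algebra by the one-dimensional Lie algebra by means of $\delta$ is the quadratic double extension of $\mathfrak G$ by means of $\delta$, with the Manin decomposition $\mathfrak U'\oplus\mathfrak V'$ where $\mathfrak U'=\mathfrak U\oplus\mathbb Ke^*$ is the direct sum of Lie algebras and $\mathfrak V'=\mathfrak V\oplus\mathbb Ke$ has the Lie structure given by the semidirect product by means of $\delta$. Special double extension: let $(\mathfrak G=\mathfrak U\oplus\mathfrak V,B,D)$ be a special symplectic Manin algebra and suppose that $\delta\in\mathrm{Der}_a(\mathfrak G,B)$, $\lambda\in\mathbb K\setminus\{0\}$ and $c\in\mathfrak V$ satisfy $[\delta,D]-\lambda\delta=\mathrm{ad}_{\mathfrak G}(c)$ and $\delta(\mathfrak V)\subseteq\mathfrak V$.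 The special double extension of $(\mathfrak G=\mathfrak U\oplus\mathfrak V,B,D)$ by means of $(\delta,c)$ is the special symplectic Manin algebra formed by the double extension of the Manin algebra $(\mathfrak G=\mathfrak U\oplus\mathfrak V,B)$ by means of $\delta$ together with the invertible skew-symmetric derivation $\tilde D$ given by $\tilde D(x)=Dx+B(c,x)e^*$ for $x\in\mathfrak G$, $\tilde D(e^* )=\lambda e^*$, $\tilde D(e)=-\lambda e-c$.
   Formalization: In (i) the conclusion holds up to exchanging U' and V' (the fixed order fails over non-closed fields); (ii) assumes g nonzero; U⊕Ke* carries the bracket inherited from the double extension, not necessarily a direct sum of Lie algebras. *)

(* Defs.v *)
From HB Require Import structures.
From mathcomp Require Import all_boot all_algebra.
From mathcomp Require Import ring.

Set Implicit Arguments.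
Unset Strict Implicit.
Unset Printing Implicit Defensive.

Import GRing.Theory.
Local Open Scope ring_scope.

Section Lie.
Variables (K : fieldType) (g : vectType K).
Variable br : {bilinear g -> g -> g}.
Implicit Types (B : {symmetric g}) (w : {skew_symmetric g}).
Implicit Types (D : 'End(g)) (W : {vspace g}).

Definition is_lie_bracket : Prop :=
  (forall x, br x x = 0) /\
  (forall x y z, br x (br y z) + br y (br z x) + br z (br x y) = 0).

Definition ad (x : g) : 'End(g) := linfun (br x).

Lemma ad_is_linear : linear ad.
Proof. by move=> a x y; apply/lfunP=> z; rewrite /ad add_lfunE scale_lfunE !lfunE /= linearPl. Qed.

HB.instance Definition _ :=
  GRing.isLinear.Build K g 'End(g) *:%R ad ad_is_linear.

Definition center : {vspace g} := lker (linfun ad).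

Lemma mem_center z : z \in center <-> forall x, br z x = 0.
Proof.
rewrite memv_ker lfunE /=; split=> [/eqP/lfunP az0 x|az0].
  by have := az0 x; rewrite /ad !lfunE.
by apply/eqP/lfunP=> x; rewrite /ad !lfunE /= az0.
Qed.

Definition is_subalgebra W : Prop :=
  forall x y, x \in W -> y \in W -> br x y \in W.

Definition is_derivation D : Prop :=
  forall x y, D (br x y) = br (D x) y + br x (D y).

Definition is_invariant_scalar_product B : Prop :=
  nondegenerate B /\ forall x y z, B (br x y) z = B x (br y z).

Definition is_skew_derivation B D : Prop :=
  is_derivation D /\ forall x y, B (D x) y = - B x (D y).

Definition is_isotropic (f : g -> g -> K) W : Prop :=
  forall x y, x \in W -> y \in W -> f x y = 0.

Definition is_symplectic_structure w : Prop :=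
  nondegenerate w /\
  forall x y z, w (br x y) z + w (br y z) x + w (br z x) y = 0.

End Lie.

(* Raw data of a Lie algebra with a form, two subspaces and an endomorphism; *)
(* the axioms are the predicates below.                                      *)
Record maninData (K : fieldType) := ManinData {
  carrier :> vectType K;
  bracket : {bilinear carrier -> carrier -> carrier};
  bform : {symmetric carrier};
  partU : {vspace carrier};
  partV : {vspace carrier};
  der : 'End(carrier) }.

Arguments bracket {K} m.
Arguments bform {K} m.
Arguments partU {K} m.
Arguments partV {K} m.
Arguments der {K} m.

Section Manin.
Variable K : fieldType.
Implicit Types g h G : maninData K.

Definition is_manin g : Prop :=
  [/\ is_lie_bracket (bracket g),
      is_invariant_scalar_product (bracket g) (bform g),
      is_subalgebra (bracket g) (partU g) /\ is_subalgebra (bracket g) (partV g),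
      is_isotropic (bform g) (partU g) /\ is_isotropic (bform g) (partV g)
    & (partU g :&: partV g = 0 /\ partU g + partV g = fullv)%VS ].

Definition is_special_symplectic_manin g : Prop :=
  [/\ is_manin g,
      is_skew_derivation (bracket g) (bform g) (der g),
      lker (der g) = 0%VS
    & (der g @: partU g <= partU g /\ der g @: partV g <= partV g)%VS ].

(* A Manin decomposition is an unordered pair of subalgebras, but a double  *)
(* extension adjoins e^* to one summand and e to the other.                 *)
Definition swap g : maninData K :=
  ManinData (bracket g) (bform g) (partV g) (partU g) (der g).

Definition manin_isomorphic g h : Prop :=
  exists f : 'Hom(carrier g, carrier h),
    [/\ bijective f,
        forall x y, f (bracket g x y) = bracket h (f x) (f y),
        forall x y, bform h (f x) (f y) = bform g x y,
        (f @: partU g = partU h /\ f @: partV g = partV h)%VS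
      & forall x, f (der g x) = der h (f x)].

End Manin.

Section DoubleExtension.
Variables (K : fieldType) (G : maninData K).
Variables (delta : 'End(carrier G)) (c : carrier G) (lambda : K).

(* The triple (a, x, a') stands for a e + x + a' e^*. *)
Definition dext_space : vectType K := (K^o * carrier G * K^o)%type.
Implicit Types u v w : dext_space.

Definition dext_bracket u v : dext_space :=
  let: (a, x, a') := u in
  let: (b, y, b') := v in
  (0, bracket G x y + a *: delta y - b *: delta x, bform G (delta x) y).

Definition dext_form u v : K :=
  let: (a, x, a') := u in
  let: (b, y, b') := v in
  bform G x y + a * b' + b * a'.

Definition dext_der_fun u : dext_space :=
  let: (a, x, a') := u in
  (- (lambda * a), der G x - a *: c, bform G c x + lambda * a').

Lemma dext_bracket_bilinear : bilinear_for
  (GRing.Scale.Law.clone _ _ *:%R _) (GRing.Scale.Law.clone _ _ *:%R _)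
  dext_bracket.
Proof.
have shuffle (p q r p1 q1 r1 : carrier G) :
    p + p1 + (q + q1) - (r + r1) = p + q - r + (p1 + q1 - r1).
  by rewrite opprD [p + p1 + _]addrACA [LHS]addrACA.
split=> [[[b y] b'] k [[a x] a'] [[a1 x1] a1']|[[a x] a'] k [[b y] b'] [[b1 y1] b1']] /=;
  congr (_, _, _); rewrite /= ?scaler0 ?addr0 //.
- by rewrite linearPl linearP scalerDl scalerDr !scalerBr scalerDr !scalerA [b * k]mulrC shuffle.
- by rewrite linearP linearPl.
- by rewrite linearPr linearP scalerDl scalerDr !scalerBr scalerDr !scalerA [a * k]mulrC shuffle.
- by rewrite linearPr.
Qed.

HB.instance Definition _ := bilinear_isBilinear.Build K
  dext_space dext_space dext_space _ _ dext_bracket dext_bracket_bilinear.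

Lemma dext_form_bilinear : bilinear_for
  (GRing.Scale.Law.clone _ _ *%R _) (GRing.Scale.Law.clone _ _ (idfun \; *%R) _)
  dext_form.
Proof.
split=> [[[b y] b'] k [[a x] a'] [[a1 x1] a1']|[[a x] a'] k [[b y] b'] [[b1 y1] b1']] /=.
  by rewrite linearPl; rewrite -![k *: _]/(k * _); ring.
by rewrite linearPr /= ; rewrite -![k *: _]/(k * _); ring.
Qed.

HB.instance Definition _ := bilinear_isBilinear.Build K
  dext_space dext_space K _ _ dext_form dext_form_bilinear.

Lemma dext_form_symmetric u v :
  dext_form u v = (-1) ^+ false * idfun (dext_form v u).
Proof.
case: u v => [[a x] a'] [[b y] b']; rewrite /= expr0 mul1r.
by rewrite [bform G x y]hermitian_subproof /= expr0 mul1r; ring.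
Qed.

HB.instance Definition _ := isHermitianSesquilinear.Build K
  dext_space false idfun dext_form dext_form_symmetric.

Lemma dext_der_fun_is_linear : linear dext_der_fun.
Proof.
move=> k [[a x] a'] [[b y] b']; congr (_, _, _) => /=.
- by rewrite mulrDr opprD scalerN scalerAr.
- by rewrite linearP scalerBr scalerDl scalerA opprD addrACA.
- by rewrite linearPr /= mulrDr scalerDr addrACA scalerAr.
Qed.

HB.instance Definition _ := GRing.isLinear.Build K
  dext_space dext_space *:%R dext_der_fun dext_der_fun_is_linear.

Definition in_G_fun (x : carrier G) : dext_space := (0, x, 0).

Lemma in_G_fun_is_linear : linear in_G_fun.
Proof. by move=> k x y; congr (_, _, _); rewrite /= scaler0 addr0. Qed.

HB.instance Definition _ := GRing.isLinear.Build K
  (carrier G) dext_space *:%R in_G_fun in_G_fun_is_linear.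

Definition in_G : 'Hom(carrier G, dext_space) := linfun in_G_fun.
Definition vec_e : dext_space := (1, 0, 0).
Definition vec_estar : dext_space := (0, 0, 1).

(* Only [der] involves [c] and [lambda]: the rest is the double extension of  *)
(* the Manin algebra by [delta]. U + K e^* carries the restricted bracket, so *)
(* it is a central extension of U by the cocycle B (delta u) u', which is     *)
(* nonzero in general: nothing forces [delta] to preserve U.                  *)
Definition special_dext : maninData K :=
  @ManinData K dext_space dext_bracket dext_form
    (in_G @: partU G + <[vec_estar]>)%VS (in_G @: partV G + <[vec_e]>)%VS
    (linfun dext_der_fun).

Definition special_dext_condition : Prop :=
  [/\ is_skew_derivation (bracket G) (bform G) delta,
      lambda != 0,
      c \in partV G,
      (delta @: partV G <= partV G)%VS
    & ((delta \o der G) - (der G \o delta) - lambda *: delta)%VF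
        = ad (bracket G) c].

End DoubleExtension.

Section SpecialDoubleExtension.
Variable K : fieldType.
Implicit Types g G : maninData K.

Definition is_special_dext g G (delta : 'End(carrier G)) (c : carrier G) : Prop :=
  exists lambda : K, special_dext_condition delta c lambda /\
    manin_isomorphic g (special_dext delta c lambda).

Inductive iterated_special_dext_dim2 : maninData K -> Prop :=
| iterated_dim2 g :
    is_special_symplectic_manin g -> \dim {:carrier g} = 2%N ->
    iterated_special_dext_dim2 g
| iterated_step g G (delta : 'End(carrier G)) (c : carrier G) :
    iterated_special_dext_dim2 G -> is_special_dext g delta c ->
    iterated_special_dext_dim2 g.

End SpecialDoubleExtension.

Lemma nondegenerateP (K : fieldType) (g : vectType K) (eps : bool)
    (f : {hermitian g for eps & idfun}) :
  nondegenerate f <-> forall x, (forall y, f x y = 0) -> x = 0.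
Proof.
rewrite /nondegenerate -subv0; split=> [/subvP f0 x fx0|f0].
  by apply/eqP; rewrite -memv0; apply: f0; apply/mem_orthovP=> y _; apply: fx0.
apply/subvP=> x /mem_orthovP fx0; rewrite memv0; apply/eqP/f0 => y.
by apply: fx0; rewrite memvf.
Qed.

Section Checks.
Variable K : fieldType.

(* The two descriptions of special symplectic Manin algebras, related by *)
(* [w x y = B (D x) y].                                                  *)
Lemma special_symplectic_formP (g : maninData K)
    (w : {skew_symmetric (carrier g)}) :
  is_manin g -> (forall x y, w x y = bform g (der g x) y) ->
  is_special_symplectic_manin g <->
  [/\ is_symplectic_structure (bracket g) w,
      is_isotropic w (partU g) & is_isotropic w (partV g)].
Proof.
move=> hg wE; have [[brxx _] [nd inv] _ [isoU isoV] [capUV addUV]] := hg.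
have {nd}ndB := (nondegenerateP (bform g)).1 nd.
have symB x y : bform g x y = bform g y x.
  by rewrite hermC expr0 mul1r.
have skw x y : w x y = - w y x.
  by rewrite hermC expr1 mulN1r.
have bracketC x y : bracket g x y = - bracket g y x.
  apply/eqP; rewrite -addr_eq0; have := brxx (x + y).
  by rewrite linearDl !linearDr !brxx add0r addr0 => ->.
split=> [[_ [derD skD] kerD [DU DV]]|[[ndw cyc] wU wV]].
  split=> [|x y Ux Uy|x y Vx Vy].
  - split=> [|x y z].
      apply/(nondegenerateP w) => x wx0.
      apply/eqP; rewrite -memv0 -kerD memv_ker; apply/eqP/ndB => y.
      by rewrite -wE.
    rewrite [w (bracket g y z) x]skw [w (bracket g z x) y]skw !wE derD linearDl.
    rewrite -(inv (der g x) y z) [bform g (der g y) _]symB (inv z x (der g y)).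
    by rewrite [bform g z _]symB; ring.
  - by rewrite wE isoU // (subvP DU) // memv_img.
  - by rewrite wE isoV // (subvP DV) // memv_img.
have {ndw}ndw := (nondegenerateP w).1 ndw.
split=> //.
- split=> [x y|x y]; last by rewrite -wE skw wE symB.
  apply/eqP; rewrite -subr_eq0; apply/eqP/ndB => z.
  rewrite linearBl /= linearDl /= -wE inv -wE.
  rewrite [bform g (bracket g x _) z]symB -(inv z x (der g y)).
  rewrite [bform g _ (der g y)]symB -wE.
  by rewrite [w x _]skw [w y _]skw -(cyc x y z); ring.
- apply/eqP; rewrite -subv0; apply/subvP=> x; rewrite memv_ker memv0 => /eqP Dx.
  by apply/eqP/ndw => y; rewrite wE Dx linear0l.
- have stable (U V : {vspace carrier g}) : (U + V = fullv)%VS ->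
      is_isotropic (bform g) U -> is_isotropic (bform g) V -> is_isotropic w U ->
      (der g @: U <= U)%VS.
    move=> UV isU isV wU0; apply/subvP=> _ /memv_imgP[u Uu ->].
    have : der g u \in (U + V)%VS by rewrite UV memvf.
    move=> /memv_addP[a Ua [b Vb Du]]; suff b0 : b = 0 by rewrite Du b0 addr0.
    apply: ndB => y; have : y \in (U + V)%VS by rewrite UV memvf.
    move=> /memv_addP[y1 Uy1 [y2 Vy2 ->]].
    have -> : b = der g u - a by rewrite Du addrC addKr.
    rewrite linearDr linearBl /= -wE (wU0 _ _ Uu Uy1) (isU _ _ Ua Uy1) subr0 add0r.
    by rewrite Du addrC addKr (isV _ _ Vb Vy2).
  by split; [apply: (stable _ (partV g)) | apply: (stable _ (partU g)); rewrite 1?addvC].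
Qed.

Section Ext.
Variables (G : maninData K) (delta : 'End(carrier G)) (c : carrier G).
Variable lambda : K.
Local Notation E := (special_dext delta c lambda).

Lemma mem_special_dextU (u : dext_space G) :
  u \in partU E <-> u.1.1 = 0 /\ u.1.2 \in partU G.
Proof.
split=> [/memv_addP[_ /memv_imgP[x Ux ->] [_ /vlineP[k ->] ->]]|].
  by rewrite lfunE /= scaler0 scaler0 !addr0.
case: u => [[a x] a'] /= [-> Ux]; apply/memv_addP.
exists (in_G G x); first exact: memv_img.
exists (a' *: vec_estar G); first by apply/vlineP; exists a'.
by rewrite lfunE; congr (_, _, _); rewrite /= ?scaler0 ?addr0 // add0r [RHS]mulr1.
Qed.

Lemma mem_special_dextV (u : dext_space G) :
  u \in partV E <-> u.2 = 0 /\ u.1.2 \in partV G.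
Proof.
split=> [/memv_addP[_ /memv_imgP[x Ux ->] [_ /vlineP[k ->] ->]]|].
  by rewrite lfunE /= scaler0 scaler0 !addr0.
case: u => [[a x] a'] /= [-> Ux]; apply/memv_addP.
exists (in_G G x); first exact: memv_img.
exists (a *: vec_e G); first by apply/vlineP; exists a.
by rewrite lfunE; congr (_, _, _); rewrite /= ?scaler0 ?addr0 // add0r [RHS]mulr1.
Qed.

Lemma special_dextP : [pchar K] =i pred0 ->
  is_special_symplectic_manin G -> special_dext_condition delta c lambda ->
  is_special_symplectic_manin E.
Proof.
move=> charK [[[brxx jac] [nd inv] [subU subV] [isoU isoV] [capUV addUV]]].
move=> [derD skD] kerD [DU DV] [[derd skd] lam0 Vc dV /lfunP comm].
have {nd}ndB := (nondegenerateP (bform G)).1 nd.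
have symB x y : bform G x y = bform G y x.
  by rewrite hermC expr0 mul1r.
have {}comm x : delta (der G x) = der G (delta x) + lambda *: delta x + bracket G c x.
  have := comm x; rewrite /ad !lfunE /= => <-; rewrite !add_lfunE !opp_lfunE !comp_lfunE scale_lfunE.
  by rewrite [RHS]addrC -[X in _ = X + _]addrA -opprD subrK.
have skd0 x : bform G (delta x) x = 0.
  have /eqP := skd x x; rewrite [bform G x _]symB -addr_eq0 -mulr2n -mulr_natl.
  by rewrite mulf_eq0 (pcharf0P K).1 //= => /eqP.

have bracketC x y : bracket G x y = - bracket G y x.
  apply/eqP; rewrite -addr_eq0; have := brxx (x + y).
  by rewrite linearDl !linearDr !brxx add0r addr0 => ->.
have {}DU x : x \in partU G -> der G x \in partU G.
  by move=> Ux; apply: (subvP DU); apply: memv_img.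
have {}DV x : x \in partV G -> der G x \in partV G.
  by move=> Ux; apply: (subvP DV); apply: memv_img.
have {}dV x : x \in partV G -> delta x \in partV G.
  by move=> Ux; apply: (subvP dV); apply: memv_img.
split.
- split.
  + split=> [[[a x] a']|[[a x] a'] [[b y] b'] [[d z] d']].
      by rewrite /= brxx add0r subrr skd0.
    congr (_, _, _) => /=; first by rewrite !addr0.
      apply: ndB => t.
      have jt : bform G (bracket G x (bracket G y z) + bracket G y (bracket G z x)
         + bracket G z (bracket G x y)) t = 0 by rewrite jac linear0l.
      move: jt; rewrite !scale0r !subr0.
      rewrite !(linearDr, linearNr, linearZr_LR) !(linearD, linearN, linearZ) /= !derd.
      rewrite !(linearDl, linearNl, linearZl_LR, linearDr, linearNr, linearZr_LR) /=.
      rewrite [bracket G (delta x) y]bracketC [bracket G (delta y) z]bracketC.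
      rewrite [bracket G (delta z) x]bracketC !linearNl => jt.
      rewrite -[RHS]jt; ring.
    rewrite !(linearDr, linearNr, linearZr_LR) /=.
    rewrite [bform G _ (bracket G y z)]skd derd linearDr /=.
    rewrite -(inv (delta y) z x) [bform G (bracket G _ z) x]symB.
    rewrite [bform G (delta z) (bracket G x y)]symB (inv x y).
    rewrite [bform G (delta z) (delta x)]symB [bform G (delta z) (delta y)]symB.
    rewrite [bform G (delta y) (delta x)]symB; ring.
  + split.
      apply/(nondegenerateP (bform E)) => -[[a x] a'] u0.
      congr (_, _, _).
      * have := u0 (0, 0, 1); rewrite /= linear0r add0r mulr1 mul0r addr0. done.
      * apply: ndB => y; have := u0 (0, y, 0). by rewrite /= mulr0 mul0r !addr0.
      * have := u0 (1, 0, 0); by rewrite /= linear0r add0r mulr0 mul1r add0r.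
    move=> [[a x] a'] [[b y] b'] [[d z] d'] /=.
    rewrite !(linearDl, linearNl, linearZl_LR, linearDr, linearNr, linearZr_LR) /=.
    by rewrite inv (skd x z) (skd x y); ring.
  + split=> [[[a x] a'] [[b y] b']|[[a x] a'] [[b y] b']].
      move=> /mem_special_dextU[/= -> Ux] /mem_special_dextU[/= -> Uy].
      apply/mem_special_dextU; split=> //=; rewrite !scale0r subr0 addr0.
      exact: subU.
    move=> /mem_special_dextV[/= _ Ux] /mem_special_dextV[/= _ Uy].
    apply/mem_special_dextV; split=> /=; first by rewrite isoV ?dV.
    by rewrite memvB ?memvD ?memvZ ?dV ?subV.
  + split=> [[[a x] a'] [[b y] b']|[[a x] a'] [[b y] b']].
      move=> /mem_special_dextU[/= -> Ux] /mem_special_dextU[/= -> Uy].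
      by rewrite isoU // !mul0r !addr0.
    move=> /mem_special_dextV[/= -> Ux] /mem_special_dextV[/= -> Uy].
    by rewrite isoV // !mulr0 !addr0.
  + split.
      apply/eqP; rewrite -subv0; apply/subvP=> -[[a x] a'] /memv_capP[].
      move=> /mem_special_dextU[/= -> Ux] /mem_special_dextV[/= -> Vx].
      suff -> : x = 0 by rewrite memv0.
      by apply/eqP; rewrite -memv0 -capUV memv_cap Ux.
    apply/vspaceP=> -[[a x] a'] ; rewrite memvf; apply/memv_addP.
    have : x \in (partU G + partV G)%VS by rewrite addUV memvf.
    move=> /memv_addP[x1 Ux1 [x2 Vx2 ->]].
    exists (0, x1, a'); first by apply/mem_special_dextU.
    exists (a, x2, 0); first by apply/mem_special_dextV.
    by congr (_, _, _); rewrite /= ?add0r ?addr0.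
- split=> [[[a x] a'] [[b y] b']|[[a x] a'] [[b y] b']]; rewrite !lfunE /=.
    congr (_, _, _) => /=; rewrite ?mulr0 ?oppr0 ?addr0 //.
    + apply/eqP; rewrite -subr_eq0; apply/eqP/ndB => t.
      rewrite [der G (_ - _)]linearB /= [der G (_ + _)]linearD /= ![der G (_ *: _)]linearZ /=.
      rewrite ![delta (_ - _)]linearB /= ![delta (_ *: _)]linearZ /= !comm derD.
      rewrite !(linearDl, linearNl, linearZl_LR, linearDr, linearNr, linearZr_LR) /=.
      rewrite [bracket G x c]bracketC linearNl /=; ring.
    + rewrite [delta (_ - _)]linearB /= [delta (_ *: _)]linearZ /= comm.
      rewrite !(linearDl, linearNl, linearZl_LR, linearDr, linearNr, linearZr_LR) /=.
      by rewrite inv (skD (delta x)) (skd c) [bform G (delta x) c]symB; ring.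
  rewrite !(linearDl, linearNl, linearZl_LR, linearDr, linearNr, linearZr_LR) /=.
  by rewrite skD [bform G x c]symB; ring.
- apply/eqP; rewrite -subv0; apply/subvP=> -[[a x] a']; rewrite memv_ker lfunE memv0.
  move=> /eqP[/eqP + + +]; rewrite oppr_eq0 mulf_eq0 (negPf lam0) /= => /eqP ->.
  rewrite scale0r subr0 => /eqP; rewrite -memv_ker kerD memv0 => /eqP ->.
  rewrite linear0r add0r => /eqP; rewrite mulf_eq0 (negPf lam0) /= => /eqP ->.
  by [].
- split; apply/subvP=> _ /memv_imgP[[[a x] a'] + ->]; rewrite lfunE.
    move=> /mem_special_dextU[/= -> Ux]; apply/mem_special_dextU => /=.
    by rewrite mulr0 oppr0 scale0r subr0 DU.
  move=> /mem_special_dextV[/= -> Vx]; apply/mem_special_dextV => /=.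
  by rewrite mulr0 addr0 isoV // memvB ?memvZ ?DV.
Qed.

End Ext.
End Checks.

(* Main.v *)
From HB Require Import structures.
Require Import Defs.
From mathcomp Require Import all_boot all_algebra.
From mathcomp Require Import ring.

Set Implicit Arguments.
Unset Strict Implicit.
Unset Printing Implicit Defensive.

Import GRing.Theory.
Local Open Scope ring_scope.
Import VectorInternalTheory.

(** Write g = U + V for the Manin decomposition, B for the form, D for the
    derivation.

    Reduction.  Let z be a central vector of U with D z = lambda z.  Isotropy of
    U forces z to pair nontrivially with V, so some e in V has B z e = 1, and
    g = K z + W + K e where W is the orthogonal of the hyperbolic plane spanned
    by z and e.  The orthogonal of z is an ideal, and W is a copy of the
    quotient of that ideal by K z: it inherits a bracket, a form, a Manin
    decomposition and a derivation, all by projecting along the plane.  Let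
    delta be ad e, and let c be minus the projection of D e.  In the coordinates
    (B y z, projection of y, B y e), with z as e^* and e as e, the structure of
    g is exactly that of the special double extension of W by (delta, c)
    ([exists_special_dext]).

    Part (i).  As D preserves U and V, the two components of an eigenvector are
    killed by D - mu, and both are central; one of them is nonzero.  If it lies
    in U the reduction applies to g, otherwise to g with U and V exchanged.

    Part (ii).  Over an algebraically closed field the reduction always applies
    with z in U ([exists_central_eigenvector]), so an induction on the dimension
    concludes.  The existence of z is a form of Jacobson's theorem that a Lie
    algebra with an invertible derivation is nilpotent.  What is needed of
    nilpotency is that the proper subalgebra U lies in a D-stable ideal M of
    codimension one: then the orthogonal of M is a D-stable line, it is central
    because M contains [g, g], and it lies in U because U is its own orthogonal.

    The ideal M comes from an Engel argument ([engel], [codim1_ideal]) in which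
    all vectors are eigenvectors of D modulo a subspace.  The nilpotency that
    Engel's theorem takes as a hypothesis is replaced by the remark that
    bracketing by an eigenvector of eigenvalue a shifts eigenvalues by a: here a
    is nonzero since D is invertible, so in characteristic 0 the shifted
    eigenvalues are pairwise distinct and only finitely many can occur. *)

(** * Eigenvectors modulo a subspace *)

Section Eigen.
Variables (K : fieldType) (V : vectType K).
Implicit Types (f : 'End(V)) (A B : {vspace V}).

Lemma eigenvalue_f2mxP f a :
  (exists2 x, x != 0 & f x = a *: x) <-> eigenvalue (f2mx f) a.
Proof.
split=> [[x x0 fx]|/eigenvalueP[v vM v0]].
  apply/eigenvalueP; exists (v2r x); last first.
    by rewrite -(inj_eq (can_inj v2rK)) linear0 in x0.
  by move: fx; rewrite unlock /= => /(congr1 v2r); rewrite r2vK linearZ.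
exists (r2v v); last by rewrite unlock /= r2vK vM linearZ.
by rewrite -(inj_eq (can_inj v2rK)) r2vK linear0.
Qed.

Lemma exists_eigenvector f (closedK : GRing.closed_field_axiom K) :
  (0 < \dim {:V})%N -> exists a, exists2 x, x != 0 & f x = a *: x.
Proof.
move=> dim_gt0.
have /(PreClosedField.closed_rootP closedK)[a ra] : size (char_poly (f2mx f)) != 1%N.
  by rewrite size_char_poly eqSS -lt0n -dimvf.
by exists a; apply/eigenvalue_f2mxP; rewrite eigenvalue_root_char.
Qed.

Lemma eigenvector_seq_vanishes f (a : nat -> K) (x : nat -> V) :
  injective a -> (forall m, f (x m) = a m *: x m) -> exists m, x m == 0.
Proof.
move=> a_inj fx; pose p := char_poly (f2mx f).
have p0 : p != 0 by rewrite monic_neq0 ?char_poly_monic.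
case: (boolP (has (fun m => x m == 0) (iota 0 (size p)))) => [/hasP[m _]|nox].
  by exists m.
have := @max_poly_roots _ p (map a (iota 0 (size p))) p0.
rewrite map_inj_uniq ?iota_uniq // size_map size_iota ltnn => abs.
suff /abs/(_ isT) : all (root p) (map a (iota 0 (size p))) by [].
apply/allP=> _ /mapP[m mp ->]; rewrite -eigenvalue_root_char.
by apply/eigenvalue_f2mxP; exists (x m) => //; apply: (hasPn nox).
Qed.

End Eigen.

Section EigenModulo.
Variables (K : fieldType) (V : vectType K).
Implicit Types (f : 'End(V)) (A B : {vspace V}).

Definition stable f A := forall x, x \in A -> f x \in A.

(** The projection onto a complement of A in B stands for the quotient map
    B -> B / A. *)
Lemma complement_projP A B x : x \in B ->
  let p := daddv_pi (B :\: A) A in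
  [/\ p x \in B, x - p x \in A & (p x == 0) = (x \in A)].
Proof.
move=> Bx p; have cap0 : ((B :\: A) :&: A = 0)%VS by rewrite capv_diff.
have Px : p x + daddv_pi A (B :\: A) x = x.
  by apply: daddv_pi_add => //; rewrite addv_diff memvE (subv_trans _ (addvSl _ _)).
have xpA : x - p x \in A by rewrite -{1}Px addrC addKr memv_pi.
split=> //; first by apply: (subvP (diffvSl B A)); apply: memv_pi.
apply/eqP/idP => [px0|Ax]; first by rewrite px0 subr0 in xpA.
apply/eqP; rewrite -memv0 -cap0 memv_cap memv_pi /=.
by rewrite -[p x](subKr x) memvB.
Qed.

Lemma exists_eigenvector_mod f A B (closedK : GRing.closed_field_axiom K) :
  stable f A -> stable f B -> ~~ (B <= A)%VS ->
  exists x a, [/\ x \in B, x \notin A & f x - a *: x \in A].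
Proof.
move=> fA fB BA; pose C := (B :\: A)%VS; pose p := daddv_pi C A.
have CB x : x \in C -> x \in B by apply/subvP/diffvSl.
have dimC : (0 < \dim {:subvs_of C})%N.
  rewrite dimvf /= lt0n dimv_eq0; apply: contra BA => /eqP C0.
  by rewrite (subv_trans (addvSl B A)) // -addv_diff -/C C0 add0v.
(* C is a copy of B / A, and T is the endomorphism that f induces on it *)
pose T : 'End(subvs_of C) := linfun (vsproj C \o p \o f \o vsval).
have [a [x x0 Tx]] := exists_eigenvector T closedK dimC.
have Cx : vsval x \in C by exact: subvsP.
exists (vsval x), a; split; first exact: CB.
  apply: contra x0 => Ax; rewrite -(inj_eq val_inj) /= -memv0.
  by rewrite -(capv_diff B A) memv_cap Cx.
have /(congr1 vsval) := Tx; rewrite lfunE /= vsprojK ?memv_pi //= => <-.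
by have [] := complement_projP A (fB _ (CB _ Cx)).
Qed.

(** An endomorphism of the quotient by A has finitely many eigenvalues, so a
    sequence of eigenvectors modulo A with distinct eigenvalues must vanish
    modulo A somewhere. *)
Lemma eigenvector_mod_seq_in f A (a : nat -> K) (x : nat -> V) :
  stable f A -> injective a -> (forall m, f (x m) - a m *: x m \in A) ->
  exists m, x m \in A.
Proof.
move=> fA a_inj fx; pose p := daddv_pi (fullv :\: A) A.
have pP y : y - p y \in A /\ (p y == 0) = (y \in A).
  by have [] := complement_projP A (memvf y).
have pA y : y \in A -> p y = 0 by rewrite -(pP y).2 => /eqP.
(* p realises the quotient by A, and the p (x m) are eigenvectors of p \o f *)
suff [m pxm0] : exists m, p (x m) == 0 by exists m; rewrite -(pP _).2.
apply: (eigenvector_seq_vanishes (f := (p \o f)%VF)) a_inj _ => m.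
rewrite comp_lfunE.
have := pA _ (fA _ (pP (x m)).1); rewrite !linearB /= => /subr0_eq <-.
by have := pA _ (fx m); rewrite linearB linearZ /= => /subr0_eq.
Qed.
End EigenModulo.

(** * Engel's theorem for a Lie algebra with an invertible derivation *)

Section Engel.
Variables (K : fieldType) (g : vectType K) (br : {bilinear g -> g -> g}).
Variable D : 'End(g).
Hypotheses (charK : [pchar K] =i pred0) (closedK : GRing.closed_field_axiom K).
Hypotheses (lie : is_lie_bracket br) (derD : is_derivation br D).
Hypothesis kerD : lker D = 0%VS.
Implicit Types (k h A B M : {vspace g}).

Definition stable_ad k A := forall y x, y \in k -> x \in A -> br y x \in A.

Lemma bracket_antisym x y : br x y = - br y x.
Proof.
have [brxx _] := lie; apply/eqP; rewrite -addr_eq0; have := brxx (x + y).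
by rewrite linearDl !linearDr !brxx add0r addr0 => ->.
Qed.

Lemma bracket_leibniz x y z : br x (br y z) = br (br x y) z + br y (br x z).
Proof.
have [_ /(_ x y z)/eqP] := lie; rewrite -addrA addr_eq0 => /eqP->.
rewrite opprD [br z (br x y)]bracket_antisym opprK addrC.
by rewrite [br z x]bracket_antisym linearNr opprK.
Qed.

(** D is injective, hence maps the finite-dimensional M onto itself: a vector
    sent into M by D is already in M. *)
Lemma eigenvalue_mod_neq0 M x a :
  stable D M -> x \notin M -> D x - a *: x \in M -> a != 0.
Proof.
move=> DM Mx Dx; apply: contraNneq Mx => a0; rewrite {}a0 scale0r subr0 in Dx.
have : (D @: M)%VS == M.
  rewrite -dimv_leqif_eq; first by rewrite limg_dim_eq // kerD capv0.
  by apply/subvP=> _ /memv_imgP[y My ->]; apply: DM.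
move=> /eqP DMM; move: Dx; rewrite -{1}DMM => /memv_imgP[y My /eqP].
by rewrite -subr_eq0 -linearB -memv_ker kerD memv0 subr_eq0 => /eqP->.
Qed.

(** In the quotient B / A, the algebra k kills a nonzero vector which is moreover
    an eigenvector of D.  The eigenvector clause is what lets the induction
    adjoin this vector to a subalgebra and keep D-stability. *)
Definition engel_prop k := forall A B,
  stable D A -> stable D B -> stable_ad k A -> stable_ad k B ->
  ~~ (B <= A)%VS ->
  exists b m, [/\ b \in B, b \notin A, D b - m *: b \in A
                & forall y, y \in k -> br y b \in A].

(** A proper D-stable subalgebra h of k is enlarged until it has codimension one:
    the Engel property of h, acting on k / h, gives a vector x of k outside h
    that normalizes h and is an eigenvector of D modulo h, so that h + K x is
    again a D-stable subalgebra, with h as an ideal.  The property is only used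
    for subalgebras smaller than k, because [engel] derives it for k from this
    lemma. *)
Lemma codim1_ideal h k :
  (forall h', (\dim h' < \dim k)%N -> stable D h' -> is_subalgebra br h' ->
     engel_prop h') ->
  stable D h -> stable D k -> is_subalgebra br h -> is_subalgebra br k ->
  (h <= k)%VS -> h != k ->
  exists M x a, [/\ stable D M, is_subalgebra br M, (h <= M)%VS,
    k = (M + <[x]>)%VS & [/\ x \notin M, D x - a *: x \in M
    & forall y, y \in M -> br y x \in M]].
Proof.
move=> IH; have [n] := ubnP (\dim k - \dim h); elim: n h => // n IHn h.
rewrite ltnS => le_n Dh Dk subh subk hk neq_hk.
have nkh : ~~ (k <= h)%VS by apply: contra neq_hk => kh; rewrite eqEsubv hk.
have lt_hk : (\dim h < \dim k)%N.
  by rewrite ltn_neqAle (dimv_leqif_eq hk) neq_hk dimvS.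
have hkk : stable_ad h k by move=> y x /(subvP hk); apply: subk.
have [x [a [kx hx Dx hxh]]] := IH h lt_hk Dh subh h k Dh Dk subh hkk nkh.
pose h1 := (h + <[x]>)%VS.
have h1k : (h1 <= k)%VS by rewrite subv_add hk -memvE.
have hh1 : (h <= h1)%VS by rewrite addvSl.
have h1x : x \in h1 by rewrite memvE addvSr.
have [eqk|neqk] := eqVneq h1 k.
  by exists h, x, a; split=> //; rewrite -eqk.
have lt_h : (\dim h < \dim h1)%N.
  rewrite ltn_neqAle dimvS // andbT (dimv_leqif_eq hh1).
  by apply: contra hx => /eqP->.
have Dxh1 : D x \in h1.
  by rewrite -[D x](subrK (a *: x)) memvD ?memvZ // (subvP hh1).
have [|||M [y [b [DM subM h1M kM My]]]] := IHn h1 _ _ Dk _ subk h1k neqk.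
- by rewrite (leq_trans _ le_n) // ltn_sub2l.
- move=> _ /memv_addP[u hu [_ /vlineP[c ->] ->]].
  by rewrite linearD linearZ memvD ?memvZ // (subvP hh1) ?Dh.
- move=> _ _ /memv_addP[u hu [_ /vlineP[c ->] ->]]
    /memv_addP[v hv [_ /vlineP[d ->] ->]].
  rewrite linearDl !linearDr !linearZl_LR !linearZr_LR /= lie.1 !scaler0 addr0.
  rewrite [br x v]bracket_antisym (subvP hh1) //.
  by rewrite !memvD ?memvZ ?memvN ?hxh ?subh.
by exists M, y, b; split=> //; apply: subv_trans h1M.
Qed.

(** By induction on dim k, with k = M + K x and M an ideal of k.  Induction
    gives b killed by M modulo A, an eigenvector of D modulo A of eigenvalue m;
    every iterate of ad x on b is again killed by M, with eigenvalue m + j a.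
    These are distinct, so some iterate lies in A, and the one just before the
    first such iterate is killed by x as well. *)
Lemma engel k : stable D k -> is_subalgebra br k -> engel_prop k.
Proof.
have [n] := ubnP (\dim k); elim: n k => // n IHn k; rewrite ltnS => le_n Dk subk.
move=> A B DA DB kA kB BA.
have [k0|k_neq0] := eqVneq k 0%VS.
  have [b [m [Bb Ab Db]]] := exists_eigenvector_mod closedK DA DB BA.
  exists b, m; split=> // y; rewrite k0 memv0 => /eqP->.
  by rewrite linear0l mem0v.
have [|||||M [x [a [DM subM _ kM [Mx Dx Mxx]]]]] :=
  @codim1_ideal 0 k _ _ Dk _ subk.
- by move=> h' lt_k Dh' subh'; apply: IHn => //; apply: leq_trans le_n.
- by move=> y; rewrite memv0 => /eqP->; rewrite linear0 mem0v.
- by move=> y z; rewrite memv0 => /eqP->; rewrite linear0l mem0v.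
- exact: sub0v.
- by rewrite eq_sym.
have Mk : (M <= k)%VS by rewrite kM addvSl.
have kx : x \in k by rewrite kM memvE addvSr.
have lt_Mk : (\dim M < n)%N.
  apply: leq_trans le_n; rewrite ltn_neqAle dimvS // andbT (dimv_leqif_eq Mk).
  by apply: contra Mx => /eqP->.
have [b [m [Bb Ab Db Mb]]] : exists b m, [/\ b \in B, b \notin A,
    D b - m *: b \in A & forall y, y \in M -> br y b \in A].
  by apply: (IHn M) => // [y z|y z] /(subvP Mk); [apply: kA|apply: kB].
have a0 := eigenvalue_mod_neq0 DM Mx Dx.
pose s j := iter j (br x) b; pose ev j := m + a *+ j.
have sP j : [/\ s j \in B, D (s j) - ev j *: s j \in A
               & forall y, y \in M -> br y (s j) \in A].
  elim: j => [|j [Bs Ds Ms]]; first by rewrite /ev addr0.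
  split=> [|| y My] /=; first exact: kB.
    rewrite -/(s j) derD.
    have -> : br (D x) (s j) + br x (D (s j)) - ev j.+1 *: br x (s j) =
              br (D x - a *: x) (s j) + br x (D (s j) - ev j *: s j).
      rewrite linearBl linearBr linearZl_LR linearZr_LR /= /ev mulrS.
      by rewrite addrCA scalerDl opprD addrACA.
    by apply: memvD; [apply: Ms | apply: kA].
  rewrite -/(s j) bracket_leibniz.
  by apply: memvD; [apply/Ms/Mxx | apply: kA => //; apply: Ms].
have [||j Aj] := eigenvector_mod_seq_in (a := ev) (x := s) DA.
- move=> i j /addrI/eqP; rewrite -!(mulr_natr a) (inj_eq (mulfI a0)).
  wlog le_ij : i j / (i <= j)%N.
    by move=> W; case/orP: (leq_total i j) => /W // E; rewrite eq_sym => /E.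
  rewrite eq_sym -subr_eq0 -natrB // (pcharf0P K).1 // subn_eq0 => le_ji.
  by apply/eqP; rewrite eqn_leq le_ij.
- by move=> j; case: (sP j).
have [] := @ex_minnP (fun j => s j \in A); first by exists j.
case=> [As0|i Ai mini]; first by rewrite As0 in Ab.
have [Bi Di Mi] := sP i.
exists (s i), (ev i); split=> //; first by apply/negP=> /mini; rewrite ltnn.
move=> y; rewrite kM => /memv_addP[u Mu [_ /vlineP[c ->] ->]].
rewrite linearDl linearZl_LR; apply: memvD; first exact: Mi.
by apply: memvZ; apply: Ai.
Qed.
End Engel.

(** * A central eigenvector in U *)

Section CentralEigenvector.
Variable K : fieldType.

(** Pairing with a basis of M is a linear map to a space of dimension dim M, so
    its kernel is nonzero. *)
Lemma exists_orthogonal (V : vectType K) (B : {symmetric V}) (M : {vspace V}) :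
  M != fullv -> exists2 z, z != 0 & forall m, m \in M -> B z m = 0.
Proof.
move=> Mfull; pose n := \dim M.
pose T_fun z : 'rV[K]_n := \row_i B z (vbasis M)`_i.
have T_lin : linear T_fun.
  by move=> k x y; apply/rowP=> i; rewrite !mxE linearPl.
pose T_linear := GRing.isLinear.Build K V 'rV[K]_n *:%R T_fun T_lin.
pose TL : {linear V -> 'rV[K]_n} := HB.pack T_fun T_linear.
pose T := linfun TL.
have lt_dim : (\dim (limg T) < \dim {:V})%N.
  apply: (@leq_ltn_trans n).
    by rewrite (leq_trans (dimvS (subvf _))) // dimvf /dim /= mul1n.
  by rewrite ltn_neqAle (dimv_leqif_eq (subvf M)) Mfull dimvS ?subvf.
have kerT : lker T != 0%VS.
  apply/eqP=> kerT; have := limg_ker_dim T fullv.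
  by rewrite kerT capv0 dimv0 add0n => dimT; rewrite dimT ltnn in lt_dim.
exists (vpick (lker T)); first by rewrite vpick0.
move=> m Mm; have := memv_pick (lker T); rewrite memv_ker lfunE /= => /eqP Tz.
rewrite (coord_vbasis Mm) linear_sumr big1 //= => i _.
have /rowP/(_ i) := Tz; rewrite !mxE => Bi.
by rewrite linearZr_LR /= Bi mulr0.
Qed.

(** With M a D-stable ideal of codimension one containing U, take z orthogonal to
    M.  Then B [z, y] t = B z [y, t] vanishes because M contains all brackets,
    z is in U because U is its own orthogonal, and skewness of D gives z the
    eigenvalue opposite to that of D on g / M. *)
Lemma exists_central_eigenvector (g : maninData K) :
  [pchar K] =i pred0 -> GRing.closed_field_axiom K ->
  is_special_symplectic_manin g -> (0 < \dim {:carrier g})%N ->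
  exists z, [/\ z != 0, z \in center (bracket g), z \in partU g
    & exists mu, der g z = mu *: z].
Proof.
move=> charK closedK.
move=> [[lie [nd inv] [subU _] [isoU isoV] [_ addUV]] [derD skD] kerD [sDU _]].
move=> dim_gt0; have ndB := (nondegenerateP (bform g)).1 nd.
have symB x y : bform g x y = bform g y x by rewrite hermC expr0 mul1r.
have orthU x : (forall u, u \in partU g -> bform g x u = 0) -> x \in partU g.
  move=> xU; have : x \in (partU g + partV g)%VS by rewrite addUV memvf.
  move=> /memv_addP[a Ua [b Vb xE]]; suff b0 : b = 0 by rewrite xE b0 addr0.
  apply: ndB => y; have : y \in (partU g + partV g)%VS by rewrite addUV memvf.
  move=> /memv_addP[u Uu [v Vv ->]].
  rewrite linearDr /= [bform g b v]isoV // addr0.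
  by rewrite -(xU _ Uu) xE linearDl /= [bform g a u]isoU // add0r.
have Ufull : partU g != fullv.
  have [v v0] : exists v : carrier g, v != 0.
    by exists (vpick fullv); rewrite vpick0 -dimv_eq0 -lt0n.
  apply: contraNneq v0 => Ufull; apply/eqP/ndB => y.
  by apply: isoU; rewrite Ufull memvf.
have engelg :=
  @engel K (carrier g) (bracket g) (der g) charK closedK lie derD kerD.
have [|||||||M [x [a [DM subM UM gM [Mx Dx Mxx]]]]] :=
  @codim1_ideal K (carrier g) (bracket g) (der g) lie (partU g) fullv => //.
- by move=> h' _; apply: engelg.
- by move=> u Uu; apply: (subvP sDU); apply: memv_img.
- by move=> u _; rewrite memvf.
- by move=> u v _ _; rewrite memvf.
- exact: subvf.
have [z z0 zM] : exists2 z, z != 0 & forall m, m \in M -> bform g z m = 0.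
  by apply: exists_orthogonal; apply: contraNneq Mx => ->; rewrite memvf.
have gP y : exists2 m, m \in M & exists c, y = m + c *: x.
  have : y \in (M + <[x]>)%VS by rewrite -gM memvf.
  by move=> /memv_addP[m Mm [_ /vlineP[c ->] ->]]; exists m => //; exists c.
exists z; split=> //.
- apply/mem_center=> y; apply: ndB => t; rewrite inv; apply: zM.
  have [m Mm [c ->]] := gP y; have [n Mn [d ->]] := gP t.
  rewrite linearDl !linearDr !linearZl_LR !linearZr_LR /= lie.1 !scaler0 addr0.
  rewrite [bracket g x n](bracket_antisym lie).
  by rewrite !memvD ?memvZ ?memvN ?Mxx ?subM.
- by apply: orthU => u /(subvP UM); apply: zM.
- exists (- a); apply/eqP; rewrite scaleNr -addr_eq0; apply/eqP/ndB => y.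
  have [m Mm [c ->]] := gP y; rewrite linearDl linearZl_LR /= skD.
  rewrite linearD linearZ /= !linearDr !linearZr_LR /= (zM _ Mm) (zM _ (DM _ Mm)).
  rewrite -[der g x](subrK (a *: x)) linearDr linearZr_LR /= (zM _ Dx); ring.
Qed.
End CentralEigenvector.

(** * Reduction by a central eigenvector *)

Section Reduction.
Variables (K : fieldType) (g : maninData K) (z e : carrier g).
Local Notation br := (bracket g).
Local Notation B := (bform g).

Definition plane_orth : {vspace carrier g} :=
  (orthov B <[z]> :&: orthov B <[e]>)%VS.
Local Notation W := plane_orth.

Lemma mem_plane_orth y : y \in W <-> B y z = 0 /\ B y e = 0.
Proof.
rewrite memv_cap !mem_orthov1; split=> [/andP[/eqP-> /eqP->] //|[-> ->]].
by rewrite eqxx.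
Qed.

(** The correction is the orthogonal projection along the plane spanned by z and
    e when B z z = B e e = 0 and B z e = 1; the vsproj only retypes its value. *)
Definition plane_proj (y : carrier g) : subvs_of W :=
  vsproj W (y - B y e *: z - B y z *: e).

Lemma plane_proj_is_linear : linear plane_proj.
Proof.
move=> k x y; rewrite /plane_proj -linearP; congr (vsproj W _).
rewrite !linearPl /= !scalerDl !opprD [k *: x + y + _]addrACA [LHS]addrACA.
by rewrite -!scalerA -!scalerBr.
Qed.
HB.instance Definition _ := GRing.isLinear.Build K
  (carrier g) (subvs_of W) *:%R plane_proj plane_proj_is_linear.

(** W need not be a subalgebra of g; projecting the bracket makes W the quotient
    of the orthogonal of z by K z. *)
Definition red_bracket (x y : subvs_of W) : subvs_of W :=
  plane_proj (br (vsval x) (vsval y)).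

Lemma red_bracket_bilinear : bilinear_for
  (GRing.Scale.Law.clone _ _ *:%R _) (GRing.Scale.Law.clone _ _ *:%R _)
  red_bracket.
Proof.
split=> [y k x x1|x k y y1]; rewrite /red_bracket.
  by rewrite linearP linearPl linearP.
by rewrite !linearP.
Qed.
HB.instance Definition _ := bilinear_isBilinear.Build K
  (subvs_of W) (subvs_of W) (subvs_of W) _ _ red_bracket red_bracket_bilinear.

Definition red_form (x y : subvs_of W) : K := B (vsval x) (vsval y).

Lemma red_form_bilinear : bilinear_for
  (GRing.Scale.Law.clone _ _ *%R _) (GRing.Scale.Law.clone _ _ (idfun \; *%R) _)
  red_form.
Proof.
split=> [y k x x1|x k y y1]; rewrite /red_form.
  by rewrite linearP linearPl.
by rewrite !linearP.
Qed.
HB.instance Definition _ := bilinear_isBilinear.Build K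
  (subvs_of W) (subvs_of W) K _ _ red_form red_form_bilinear.

Lemma red_form_symmetric x y : red_form x y = (-1) ^+ false * idfun (red_form y x).
Proof. exact: hermC. Qed.
HB.instance Definition _ := isHermitianSesquilinear.Build K
  (subvs_of W) false idfun red_form red_form_symmetric.

Definition reduction : maninData K :=
  @ManinData K (subvs_of W) red_bracket red_form
    (linfun vsval @^-1: partU g)%VS (linfun vsval @^-1: partV g)%VS
    (linfun (plane_proj \o der g \o vsval)).

Lemma mem_redU x : (x \in partU reduction) = (vsval x \in partU g).
Proof. by rewrite -memv_preim lfunE. Qed.

Lemma mem_redV x : (x \in partV reduction) = (vsval x \in partV g).
Proof. by rewrite -memv_preim lfunE. Qed.

Variable lambda : K.
Hypotheses (hg : is_special_symplectic_manin g).
Hypotheses (zC : z \in center br) (zU : z \in partU g) (eV : e \in partV g).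
Hypotheses (Bze : B z e = 1) (Dz : der g z = lambda *: z).

Definition red_delta : 'End(carrier reduction) :=
  linfun (@plane_proj \o br e \o vsval).

(** The multiple of e cancels the component of D e along e, so that the argument
    already lies in W, and in V: see [vsval_red_c]. *)
Definition red_c : carrier reduction := plane_proj (- (der g e + lambda *: e)).

Let symB x y : B x y = B y x.
Proof. by rewrite hermC expr0 mul1r. Qed.

Let br_antisym x y : br x y = - br y x.
Proof. by case: hg => [[lie _ _ _ _] _ _ _]; apply: bracket_antisym. Qed.

Let brz x : br z x = 0. Proof. exact: (mem_center br z).1. Qed.
Let brxz x : br x z = 0. Proof. by rewrite br_antisym brz oppr0. Qed.

Let invB x y t : B (br x y) t = B x (br y t).
Proof. by case: hg => [[_ [_ inv] _ _ _] _ _ _]. Qed.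

Let skD x y : B (der g x) y = - B x (der g y).
Proof. by case: hg => [_ [_ sk] _ _]. Qed.

Let isoU : is_isotropic B (partU g).
Proof. by case: hg => [[_ _ _ [? _] _] _ _ _]. Qed.
Let isoV : is_isotropic B (partV g).
Proof. by case: hg => [[_ _ _ [_ ?] _] _ _ _]. Qed.

Let DU x : x \in partU g -> der g x \in partU g.
Proof. by case: hg => [_ _ _ [/subvP sDU _]] Ux; apply/sDU/memv_img. Qed.
Let DV x : x \in partV g -> der g x \in partV g.
Proof. by case: hg => [_ _ _ [_ /subvP sDV]] Vx; apply/sDV/memv_img. Qed.

Let Bzz : B z z = 0. Proof. exact: isoU. Qed.
Let Bee : B e e = 0. Proof. exact: isoV. Qed.
Let Bez : B e z = 1. Proof. by rewrite symB. Qed.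

Let vsvalz (x : subvs_of W) : B (vsval x) z = 0.
Proof. by case: ((mem_plane_orth _).1 (subvsP x)). Qed.
Let vsvale (x : subvs_of W) : B (vsval x) e = 0.
Proof. by case: ((mem_plane_orth _).1 (subvsP x)). Qed.

Lemma vsval_plane_proj y : vsval (plane_proj y) = y - B y e *: z - B y z *: e.
Proof.
rewrite vsprojK //; apply/mem_plane_orth.
rewrite !linearBl !linearZl_LR /= Bzz Bee Bze Bez !mulr0 !mulr1 !subr0.
by rewrite !subrr.
Qed.

Lemma plane_projz : plane_proj z = 0.
Proof.
by apply: val_inj; rewrite /= vsval_plane_proj Bze Bzz scale0r scale1r subrr subr0.
Qed.

Lemma plane_proje : plane_proj e = 0.
Proof.
by apply: val_inj; rewrite /= vsval_plane_proj Bez Bee scale0r scale1r subr0 subrr.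
Qed.

Lemma vsval_plane_proj_orth y : B y z = 0 -> vsval (plane_proj y) = y - B y e *: z.
Proof. by rewrite vsval_plane_proj => ->; rewrite scale0r subr0. Qed.

Lemma plane_proj_vsval x : plane_proj (vsval x) = x.
Proof.
by apply: val_inj; rewrite /= vsval_plane_proj vsvalz vsvale !scale0r !subr0.
Qed.

Let Bbrz x y : B (br x y) z = 0.
Proof. by rewrite invB brxz linear0r. Qed.

Let BDz x : B x z = 0 -> B (der g x) z = 0.
Proof. by rewrite skD Dz linearZr_LR /= => ->; rewrite mulr0 oppr0. Qed.

(** W is orthogonal to z and e, so pairing with W does not see the projection. *)
Lemma form_plane_proj y (x : subvs_of W) :
  B (vsval (plane_proj y)) (vsval x) = B y (vsval x).
Proof.
rewrite vsval_plane_proj !linearBl !linearZl_LR /=.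
by rewrite [B z _]symB [B e _]symB vsvalz vsvale !mulr0 !subr0.
Qed.

Lemma bracket_plane_projE x y :
  br x (vsval (plane_proj y)) = br x y - B y z *: br x e.
Proof.
by rewrite vsval_plane_proj !linearBr !linearZr_LR /= brxz scaler0 subr0.
Qed.

(** On the orthogonal of z the projection only removes a multiple of z, which is
    central.  This carries each identity of g over to the reduction. *)
Lemma bracket_plane_proj x y : B y z = 0 -> br x (vsval (plane_proj y)) = br x y.
Proof.
by rewrite bracket_plane_projE => ->; rewrite scale0r subr0.
Qed.

Lemma plane_proj_der y : B y z = 0 ->
  plane_proj (der g (vsval (plane_proj y))) = plane_proj (der g y).
Proof.
move=> yz; rewrite vsval_plane_proj_orth // !linearB !linearZ /= Dz.
by rewrite linearZ /= plane_projz scaler0 oppr0 scaler0 addr0.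
Qed.

Lemma reduction_bracketE x y :
  bracket reduction x y = plane_proj (br (vsval x) (vsval y)).
Proof. by []. Qed.

Lemma reduction_formE x y : bform reduction x y = B (vsval x) (vsval y).
Proof. by []. Qed.

Lemma reduction_derE x : der reduction x = plane_proj (der g (vsval x)).
Proof. by rewrite lfunE. Qed.

Let lam0 : lambda != 0.
Proof.
have [_ _ kerD _] := hg.
apply/eqP=> lam0; have : z \in lker (der g) by rewrite memv_ker Dz lam0 scale0r.
rewrite kerD memv0 => /eqP z0; have := Bze.
by rewrite z0 linear0l => /eqP; rewrite eq_sym oner_eq0.
Qed.

Lemma reduction_special_symplectic : is_special_symplectic_manin reduction.
Proof.
have [[[brxx jac] [nd _] [subU subV] _ [capUV addUV]] [derD _] kerD _] := hg.
split.
- split.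
  + split=> [x|x y t]; rewrite !reduction_bracketE ?brxx ?linear0 //.
    by rewrite !bracket_plane_proj // -!linearD /= jac linear0.
  + split=> [|x y t].
      apply/nondegenerateP=> x x0; apply: val_inj; apply: (nondegenerateP B).1 => // y.
      have := x0 (plane_proj y).
      by rewrite reduction_formE symB form_plane_proj symB.
    rewrite !reduction_formE !reduction_bracketE form_plane_proj invB.
    by rewrite [RHS]symB form_plane_proj symB.
  + split=> x y; rewrite ?(mem_redU, mem_redV) => Ux Uy.
      by rewrite vsval_plane_proj_orth // memvB ?memvZ ?subU.
    by rewrite vsval_plane_proj_orth // isoV ?scale0r ?subr0 ?subV.
  + by split=> x y; rewrite ?(mem_redU, mem_redV); [apply: isoU | apply: isoV].
  + split.
      apply/eqP; rewrite -subv0; apply/subvP=> x; rewrite memv_cap mem_redU mem_redV.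
      by rewrite -memv_cap capUV !memv0.
    apply/vspaceP=> x; rewrite memvf; apply/memv_addP.
    have : vsval x \in (partU g + partV g)%VS by rewrite addUV memvf.
    move=> /memv_addP[u Uu [v Vv xE]].
    have uz : B u z = 0 by apply: isoU.
    have ve : B v e = 0 by apply: isoV.
    have vz : B v z = 0 by have := vsvalz x; rewrite xE linearDl /= uz add0r.
    exists (plane_proj u).
      by rewrite mem_redU vsval_plane_proj_orth // memvB ?memvZ.
    exists (plane_proj v).
      by rewrite mem_redV vsval_plane_proj_orth // ve scale0r subr0.
    by rewrite -linearD /= -xE plane_proj_vsval.
- split=> x y; rewrite !reduction_derE !(reduction_bracketE, reduction_formE).
    rewrite plane_proj_der // derD linearD /= bracket_plane_proj ?BDz //.
    by rewrite [br (vsval (plane_proj _)) _]br_antisym bracket_plane_proj ?BDz // -br_antisym.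
  by rewrite form_plane_proj skD [B _ (vsval (plane_proj _))]symB form_plane_proj symB.
- apply/eqP; rewrite -subv0; apply/subvP=> x.
  rewrite memv_ker reduction_derE memv0 => /eqP /(congr1 vsval).
  rewrite vsval_plane_proj_orth ?BDz //= => /subr0_eq Dx.
  have : vsval x - (B (der g (vsval x)) e / lambda) *: z \in lker (der g).
    by rewrite memv_ker linearB linearZ /= Dz scalerA mulfVK // -Dx subrr.
  rewrite kerD memv0 subr_eq0 => /eqP xz.
  by rewrite -(inj_eq val_inj) -[x]plane_proj_vsval xz linearZ /= plane_projz scaler0.
- split; apply/subvP=> _ /memv_imgP[x + ->]; rewrite ?(mem_redU, mem_redV) => Ux.
    by rewrite reduction_derE vsval_plane_proj_orth ?BDz // memvB ?memvZ ?DU.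
  rewrite reduction_derE vsval_plane_proj_orth ?BDz //.
  by rewrite [B _ e]isoV ?DV // scale0r subr0 DV.
Qed.

Let Bbre x : B (br e x) e = 0.
Proof.
have [[[brxx _] _ _ _ _] _ _ _] := hg.
by rewrite br_antisym linearNl /= invB brxx linear0r oppr0.
Qed.

Let BDez : B (der g e) z = - lambda.
Proof. by rewrite skD Dz linearZr_LR /= Bez mulr1. Qed.

Lemma bracket2_plane_proj x y :
  br (vsval (plane_proj x)) (vsval (plane_proj y)) =
  br x y - B x z *: br e y + B y z *: br e x.
Proof.
have [[[brxx _] _ _ _ _] _ _ _] := hg.
rewrite bracket_plane_projE [br _ y]br_antisym [br _ e]br_antisym !bracket_plane_projE.
rewrite brxx scaler0 subr0 scalerN opprK opprD opprK.
by rewrite [br y x]br_antisym [br y e]br_antisym opprK scalerN.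
Qed.

Lemma red_deltaE x : red_delta x = plane_proj (br e (vsval x)).
Proof. by rewrite lfunE. Qed.

Lemma vsval_red_delta x : vsval (red_delta x) = br e (vsval x).
Proof. by rewrite red_deltaE vsval_plane_proj_orth // Bbre scale0r subr0. Qed.

Lemma vsval_red_c : vsval red_c = - (der g e + lambda *: e).
Proof.
rewrite vsval_plane_proj_orth; last first.
  by rewrite linearNl linearDl linearZl_LR /= BDez Bez mulr1 addNr oppr0.
by rewrite isoV ?scale0r ?subr0 // memvN memvD ?memvZ ?DV.
Qed.

Lemma reduction_special_dext_condition :
  special_dext_condition red_delta red_c lambda.
Proof.
have [[lie _ [_ subV] _ _] [derD _] _ _] := hg.
split=> //.
- split=> x y.
    rewrite !reduction_bracketE !vsval_red_delta red_deltaE bracket_plane_proj //.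
    by rewrite (bracket_leibniz lie) linearD.
  by rewrite !reduction_formE !vsval_red_delta br_antisym linearNl /= invB.
- by rewrite mem_redV vsval_red_c memvN memvD ?memvZ ?DV.
- apply/subvP=> _ /memv_imgP[x + ->].
  by rewrite !mem_redV vsval_red_delta => Vx; apply: subV.
- apply/lfunP=> x; rewrite /ad [RHS]lfunE /=.
  rewrite !add_lfunE !opp_lfunE !comp_lfunE scale_lfunE.
  rewrite reduction_derE red_deltaE bracket_plane_proj ?BDz //.
  rewrite reduction_derE red_deltaE plane_proj_der // derD.
  rewrite reduction_bracketE vsval_red_c linearNl linearDl linearZl_LR /=.
  by rewrite !(linearD, linearN, linearZ) /= [X in X + _]addrC subrK.
Qed.

Definition split_fun (y : carrier g) :
    carrier (special_dext red_delta red_c lambda) :=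
  (B y z, plane_proj y, B y e).

Lemma split_fun_is_linear : linear split_fun.
Proof.
by move=> k x y; congr (_, _, _); rewrite /= ?linearPl ?linearP.
Qed.
HB.instance Definition _ := GRing.isLinear.Build K
  (carrier g) (carrier (special_dext red_delta red_c lambda)) *:%R split_fun
  split_fun_is_linear.

Definition unsplit_fun (u : dext_space reduction) : carrier g :=
  u.1.1 *: e + vsval (u.1.2 : subvs_of W) + u.2 *: z.

Lemma split_funK : cancel split_fun unsplit_fun.
Proof.
by move=> y; rewrite /unsplit_fun /= vsval_plane_proj [_ *: e + _]addrC !subrK.
Qed.

Lemma unsplit_funK : cancel unsplit_fun split_fun.
Proof.
move=> [[a x] a']; congr (_, _, _); rewrite /unsplit_fun /=.
- by rewrite !linearDl !linearZl_LR /= Bez Bzz vsvalz mulr1 mulr0 !addr0.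
- rewrite !linearD !linearZ /= plane_projz plane_proje !scaler0.
  by rewrite plane_proj_vsval addr0 add0r.
- by rewrite !linearDl !linearZl_LR /= Bee Bze vsvale mulr1 mulr0 !add0r.
Qed.

Lemma reduction_isomorphic :
  manin_isomorphic g (special_dext red_delta red_c lambda).
Proof.
have [[lie _ [_ subV] _ _] [derD _] _ _] := hg.
exists (linfun split_fun); split.
- exists unsplit_fun => u; rewrite lfunE; [exact: split_funK | exact: unsplit_funK].
- move=> x y; rewrite !lfunE; congr (_, _, _) => //=.
    rewrite !red_deltaE reduction_bracketE bracket2_plane_proj !bracket_plane_projE.
    rewrite lie.1 !scaler0 !subr0 linearD linearB !linearZ /=.
    by rewrite !scalerN [X in X + _ - _]addrAC subrK addrK.
  rewrite -[RHS]/(B (vsval (red_delta (plane_proj x))) (vsval (plane_proj y))).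
  rewrite red_deltaE form_plane_proj bracket_plane_projE lie.1 scaler0 subr0.
  rewrite [RHS]symB vsval_plane_proj !linearBl !linearZl_LR /=.
  rewrite [B z _]symB [B e (br e x)]symB.
  by rewrite Bbre Bbrz !mulr0 !subr0 [RHS]symB invB symB.
- move=> x y; rewrite !lfunE /= reduction_formE form_plane_proj symB vsval_plane_proj.
  rewrite !linearBl !linearZl_LR /= [B z x]symB [B e x]symB [B y x]symB.
  by ring.
- split; apply/vspaceP=> u; apply/memv_imgP/idP => [[x Ux ->]|].
  + rewrite lfunE; apply/mem_special_dextU; split; first exact: isoU.
    by rewrite /= mem_redU (vsval_plane_proj_orth (isoU Ux zU)) memvB ?memvZ.
  + move=> /mem_special_dextU[u0 Uu]; exists (unsplit_fun u).
      by rewrite /unsplit_fun u0 scale0r add0r memvD ?memvZ // -mem_redU.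
    by rewrite lfunE /= unsplit_funK.
  + rewrite lfunE; apply/mem_special_dextV; split; first exact: isoV.
    by rewrite /= mem_redV vsval_plane_proj (isoV Ux eV) scale0r subr0 memvB ?memvZ.
  + move=> /mem_special_dextV[u0 Vu]; exists (unsplit_fun u).
      by rewrite /unsplit_fun u0 scale0r addr0 memvD ?memvZ // -mem_redV.
    by rewrite lfunE /= unsplit_funK.
- move=> x; rewrite !lfunE; congr (_, _, _); rewrite /=.
  + by rewrite skD Dz linearZr_LR.
  + rewrite lfunE /= vsval_plane_proj /red_c.
    rewrite !(linearB, linearZ, linearN, linearD) /= Dz.
    rewrite !linearZ /= plane_projz plane_proje.
    by rewrite !(oppr0, scaler0, addr0, opprK) scalerN subrK.
  + rewrite -[red_form _ _]/(B (vsval red_c) (vsval (plane_proj x))) form_plane_proj.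
    rewrite vsval_plane_proj !(linearBr, linearZr_LR).
    rewrite !(linearNl, linearDl, linearZl_LR) /= BDez Bez Bee.
    by rewrite [B (der g e) e](isoV (DV eV) eV) skD symB [B e x]symB; ring.
Qed.

Lemma dim_reduction : \dim {:carrier g} = (\dim {:carrier reduction}).+2.
Proof.
have [f [[finv fK finvK] _ _ _ _]] := reduction_isomorphic.
have kerf : lker f == 0%VS by apply/lker0P/can_inj.
have imf : limg f = fullv.
  by apply/vspaceP=> u; rewrite memvf -(finvK u) memv_img ?memvf.
have := limg_dim_eq (f := f) (U := fullv).
rewrite (eqP kerf) capv0 => /(_ erefl) <-.
by rewrite imf !dimvf; apply: addn1.
Qed.

End Reduction.

(** * The theorem *)

Lemma exists_special_dext (K : fieldType) (g : maninData K)
    (z : carrier g) (mu : K) :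
  is_special_symplectic_manin g -> z != 0 -> z \in center (bracket g) ->
  z \in partU g -> der g z = mu *: z ->
  exists (G : maninData K) (delta : 'End(carrier G)) (c : carrier G),
    [/\ is_special_symplectic_manin G, is_special_dext g delta c
      & \dim {:carrier g} = (\dim {:carrier G}).+2].
Proof.
move=> hg z0 zC zU Dz.
have [[_ [nd _] _ [isoU _] [_ addUV]] _ _ _] := hg.
have [e Ve Bze] : exists2 e, e \in partV g & bform g z e = 1.
  pose Bz := linfun (bform g z : carrier g -> K^o).
  have [/subvP Vz|] := boolP (partV g <= lker Bz)%VS.
    case/eqP: z0; apply: (nondegenerateP (bform g)).1 => // y.
    have : y \in (partU g + partV g)%VS by rewrite addUV memvf.
    move=> /memv_addP[u Uu [v /Vz + ->]].
    by rewrite memv_ker lfunE /= linearDr /= (isoU z u) // => /eqP->; rewrite addr0.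
  case/subvPn=> v Vv; rewrite memv_ker lfunE /= => zv.
  exists ((bform g z v)^-1 *: v); first exact: memvZ.
  by rewrite linearZr_LR /= mulVf.
exists (reduction z e), (red_delta z e), (red_c z e mu); split.
- exact: (reduction_special_symplectic hg zC zU Ve Bze Dz).
- exists mu; split; first exact: (reduction_special_dext_condition hg zC zU Ve Bze Dz).
  exact: (reduction_isomorphic hg zC zU Ve Bze Dz).
- exact: (dim_reduction hg zC zU Ve Bze Dz).
Qed.

Lemma swap_special_symplectic (K : fieldType) (g : maninData K) :
  is_special_symplectic_manin g -> is_special_symplectic_manin (swap g).
Proof.
move=> [[lie inv [subU subV] [isoU isoV] [capUV addUV]] skD kerD [sDU sDV]].
by split=> //; split=> //; rewrite capvC addvC.
Qed.

(** Each reduction removes the plane spanned by z and e, so the dimension drops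
    by two; it can only reach 0 from a two-dimensional algebra, where the
    iteration has already stopped. *)
Lemma iterated_special_dext (K : fieldType) (g : maninData K) :
  [pchar K] =i pred0 -> GRing.closed_field_axiom K ->
  is_special_symplectic_manin g -> (0 < \dim {:carrier g})%N ->
  iterated_special_dext_dim2 g.
Proof.
move=> charK closedK; have [n] := ubnP (\dim {:carrier g}).
elim: n g => // n IHn g; rewrite ltnS => le_n hg dim_gt0.
have [z [z0 zC zU [mu Dz]]] := exists_central_eigenvector charK closedK hg dim_gt0.
have [G [delta [c [hG gG dimG]]]] := exists_special_dext hg z0 zC zU Dz.
have [G0|G_gt0] := posnP (\dim {:carrier G}).
  by apply: iterated_dim2; rewrite ?dimG ?G0.
apply: (iterated_step _ gG); apply: IHn => //.
by apply: leq_trans le_n; rewrite dimG.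
Qed.

Theorem theorem5p8 (K : fieldType) (charK : [pchar K] =i pred0)
    (g : maninData K) (hg : is_special_symplectic_manin g) :
  ((exists z : carrier g,
      [/\ z != 0,
          z \in ((center (bracket g) :&: partU g)
                  + (center (bracket g) :&: partV g))%VS
        & exists mu : K, der g z = mu *: z]) ->
   exists (G : maninData K) (delta : 'End(carrier G)) (c : carrier G),
     is_special_symplectic_manin G /\
     (is_special_dext g delta c \/ is_special_dext (swap g) delta c))
  /\
  (GRing.closed_field_axiom K -> (0 < \dim {:carrier g})%N ->
   iterated_special_dext_dim2 g).
Proof.
split=> [[z [z0 zUV [mu Dz]]]|closedK]; last exact: iterated_special_dext.
have [[_ _ _ _ [capUV _]] _ _ [/subvP sDU /subvP sDV]] := hg.
have /memv_addP[u + [v + zE]] := zUV.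
move=> /memv_capP[uC Uu] /memv_capP[vC Vv].
have Duv : der g u - mu *: u = mu *: v - der g v.
  move: Dz; rewrite zE linearD scalerDr /= => Dz.
  by apply/eqP; rewrite subr_eq [_ + mu *: u]addrC addrA -Dz addrK.
(* (D - mu) u = - (D - mu) v lies in both U and V *)
have Dmem : der g u - mu *: u \in (partU g :&: partV g)%VS.
  rewrite memv_cap; apply/andP; split.
    by rewrite memvB ?memvZ // sDU ?memv_img.
  by rewrite Duv memvB ?memvZ // sDV ?memv_img.
have Du : der g u = mu *: u by apply/subr0_eq/eqP; rewrite -memv0 -capUV.
have Dv : der g v = mu *: v.
  by apply/esym/subr0_eq; rewrite -Duv Du subrr.
have [u0|u0] := eqVneq u 0.
  have v0 : v != 0 by apply: contraNneq z0 => v0; rewrite zE u0 v0 addr0.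
  have [G [delta [c [hG gG _]]]] :=
    exists_special_dext (g := swap g) (swap_special_symplectic hg) v0 vC Vv Dv.
  by exists G, delta, c; split=> //; right.
have [G [delta [c [hG gG _]]]] := exists_special_dext hg u0 uC Uu Du.
by exists G, delta, c; split=> //; left.
Qed.
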